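(* The system $\textsf{M}$ proves: every standard $\varphi^2$ has a standard upper bound on Cantor space, i.e. $(\forall^{\mathrm{st}}\varphi^2)(\exists^{\mathrm{st}}n_0^0)(\forall f^1\le_11)(\varphi(f)\le_0n_0)$; likewise every standard $\varphi^2$ has a standard upper bound on any standard compact space $\{f^1:f\le_1h_0\}$, $h_0^1$ standard.
   Context: $f\le_1h$ means $(\forall n^0)(f(n)\le h(n))$, and $f\le_11$ means $f(n)\le1$ for all $n$. A standard compact (sub)space (of Baire space) is a set $\{f^1:f\le_1h_0\}$ for fixed standard $h_0$. Type $0$ is the type of natural numbers, $1$ is $0\to0$, $2$ is $1\to0$; superscripts denote types. $\textsf{E-PA}^{\omega}$ is classical Peano arithmetic in all finite types with the axiom of extensionality. Strong majorizability $\le^*$: $x\le^*_0y$ is $x\le_0y$, and $x\le^*_{\rho\to\sigma}y$ is $(\forall v)(\forall u\le^*_\rho v)(xu\le^*_\sigma yv\wedge yu\le^*_\sigma yv)$. An object $x$ is monotone if $x\le^*x$; $\tilde\forall,\tilde\exists$ denote quantifiers over monotone objects. The language of $\textsf{E-PA}^{\omega}_{\mathrm{st}}$ adds a predicate $\mathrm{st}^\sigma$ (``is standard'') for each finite type $\sigma$. A formula is internal if it does not involve $\mathrm{st}$. $(\forall^{\mathrm{st}}x)\Phi$ is $(\forall x)(\mathrm{st}(x)\to\Phi)$ and $(\exists^{\mathrm{st}}x)\Phi$ is $(\exists x)(\mathrm{st}(x)\wedge\Phi)$. $\textsf{E-PA}^{\omega}_{\mathrm{st}}$ is $\textsf{E-PA}^{\omega}$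 plus: (1) $x=_\sigma y\to(\mathrm{st}(x)\to\mathrm{st}(y))$; (2) $\mathrm{st}(y)\to(x\le^*_\sigma y\to\mathrm{st}(x))$; (3) $\mathrm{st}(t)$ for each closed term $t$; (4) $\mathrm{st}(z^{\sigma\to\tau})\to(\mathrm{st}(x^\sigma)\to\mathrm{st}(zx))$; and external induction $\Phi(0)\wedge(\forall^{\mathrm{st}}n^0)(\Phi(n)\to\Phi(n+1))\to(\forall^{\mathrm{st}}n^0)\Phi(n)$ for any $\Phi$. $\textsf{M}$ is $\textsf{E-PA}^{\omega}_{\mathrm{st}}$ plus, for internal $\varphi$: monotone choice $\textsf{mAC}^\omega_{\mathrm{st}}$: $(\tilde\forall^{\mathrm{st}}x)(\tilde\exists^{\mathrm{st}}y)\varphi(x,y)\to(\tilde\exists^{\mathrm{st}}f)(\tilde\forall^{\mathrm{st}}x)(\exists y\le^*f(x))\varphi(x,y)$; realization $\textsf{R}^\omega$: $(\forall x)(\exists^{\mathrm{st}}y)\varphi(x,y)\to(\tilde\exists^{\mathrm{st}}z)(\forall x)(\exists y\le^*z)\varphi(x,y)$; and $\textsf{MAJ}^\omega_{\mathrm{st}}$: $(\forall^{\mathrm{st}}x)(\exists^{\mathrm{st}}y)(x\le^*y)$. *)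

(* Defs.v *)
(* Plain Rocq with Stdlib lists.  The systems are deeply embedded: intrinsically
   typed terms and formulas with de Bruijn variables, and provability as an
   inductive predicate. *)
From Stdlib Require Import List.
Import ListNotations.

Set Implicit Arguments.

Inductive ftype : Type :=
| nat0 : ftype
| arr : ftype -> ftype -> ftype.

Declare Scope ftype_scope.
Delimit Scope ftype_scope with ftype.
Bind Scope ftype_scope with ftype.
Notation "s ==> t" := (arr s t) (at level 55, right associativity) : ftype_scope.
Open Scope ftype_scope.

Definition ty1 : ftype := nat0 ==> nat0.
Definition ty2 : ftype := ty1 ==> nat0.

(* [ctx] lists the types of the free variables, the most recently bound one
   first. *)
Definition ctx := list ftype.

Inductive var : ctx -> ftype -> Type :=
| V0 : forall G s, var (s :: G) s
| VS : forall G s r, var G s -> var (r :: G) s.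

Arguments V0 {G s}.
Arguments VS {G s r} v.

(* The recursor satisfies R 0 y z = y and R (S x) y z = z (R x y z) x. *)
Inductive term (G : ctx) : ftype -> Type :=
| Var : forall s, var G s -> term G s
| App : forall s t, term G (s ==> t) -> term G s -> term G t
| Zero : term G nat0
| Succ : term G (nat0 ==> nat0)
| Pi : forall s t, term G (s ==> t ==> s)
| Sigma : forall r s t, term G ((r ==> s ==> t) ==> (r ==> s) ==> r ==> t)
| Rec : forall s, term G (nat0 ==> s ==> (s ==> nat0 ==> s) ==> s).

Arguments Var {G s} v.
Arguments App {G s t} a b.
Arguments Zero {G}.
Arguments Succ {G}.
Arguments Pi {G s t}.
Arguments Sigma {G r s t}.
Arguments Rec {G s}.

Declare Scope term_scope.
Delimit Scope term_scope with term.
Bind Scope term_scope with term.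
Notation "a @ b" := (App a b) (at level 11, left associativity) : term_scope.
Notation "#0" := (Var V0) (at level 0) : term_scope.
Notation "#1" := (Var (VS V0)) (at level 0) : term_scope.
Notation "#2" := (Var (VS (VS V0))) (at level 0) : term_scope.
Notation "#3" := (Var (VS (VS (VS V0)))) (at level 0) : term_scope.
Open Scope term_scope.

Inductive form (G : ctx) : Type :=
| Bot : form G
| Eq0 : term G nat0 -> term G nat0 -> form G
| St : forall s, term G s -> form G
| And : form G -> form G -> form G
| Or : form G -> form G -> form G
| Imp : form G -> form G -> form G
| All : forall s, form (s :: G) -> form G
| Ex : forall s, form (s :: G) -> form G.

Arguments Bot {G}.
Arguments Eq0 {G} a b.
Arguments St {G s} a.
Arguments And {G} A B.
Arguments Or {G} A B.
Arguments Imp {G} A B.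
Arguments All {G} s A.
Arguments Ex {G} s A.

Declare Scope form_scope.
Delimit Scope form_scope with form.
Bind Scope form_scope with form.
Notation "A && B" := (And A B) (at level 40, left associativity) : form_scope.
Notation "A || B" := (Or A B) (at level 50, left associativity) : form_scope.
Notation "A --> B" := (Imp A B) (at level 55, right associativity) : form_scope.
Open Scope form_scope.

Definition Not {G} (A : form G) : form G := A --> Bot.

Fixpoint internal {G} (A : form G) : Prop :=
  match A with
  | Bot => True
  | Eq0 _ _ => True
  | St _ => False
  | And A B => internal A /\ internal B
  | Or A B => internal A /\ internal B
  | Imp A B => internal A /\ internal B
  | All _ A => internal A
  | Ex _ A => internal A
  end.

Definition renaming (G D : ctx) := forall s, var G s -> var D s.
Definition substitution (G D : ctx) := forall s, var G s -> term D s.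

Fixpoint tren {G D} (f : renaming G D) {s} (t : term G s) : term D s :=
  match t with
  | Var v => Var (f _ v)
  | App a b => tren f a @ tren f b
  | Zero => Zero
  | Succ => Succ
  | Pi => Pi
  | Sigma => Sigma
  | Rec => Rec
  end.

Definition shift {G r} : renaming G (r :: G) := fun _ v => VS v.

Definition twk {G r s} (t : term G s) : term (r :: G) s := tren shift t.

Fixpoint tsub {G D} (f : substitution G D) {s} (t : term G s) : term D s :=
  match t with
  | Var v => f _ v
  | App a b => tsub f a @ tsub f b
  | Zero => Zero
  | Succ => Succ
  | Pi => Pi
  | Sigma => Sigma
  | Rec => Rec
  end.

Definition rup {G D} (r : ftype) (f : renaming G D) : renaming (r :: G) (r :: D) :=
  fun s v =>
    match v in var G1 s1 return
      match G1 with
      | [] => unit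
      | r1 :: G2 => renaming G2 D -> var (r1 :: D) s1
      end with
    | V0 => fun _ => V0
    | VS w => fun g => VS (g _ w)
    end f.

Definition scons {G D r} (t : term D r) (f : substitution G D) :
    substitution (r :: G) D :=
  fun s v =>
    match v in var G1 s1 return
      match G1 with
      | [] => unit
      | r1 :: G2 => term D r1 -> substitution G2 D -> term D s1
      end with
    | V0 => fun u _ => u
    | VS w => fun _ g => g _ w
    end t f.

Definition sup {G D} (r : ftype) (f : substitution G D) :
    substitution (r :: G) (r :: D) :=
  scons #0 (fun _ v => twk (f _ v)).

Fixpoint fren {G D} (f : renaming G D) (A : form G) : form D :=
  match A with
  | Bot => Bot
  | Eq0 a b => Eq0 (tren f a) (tren f b)
  | St a => St (tren f a)
  | And A B => fren f A && fren f B
  | Or A B => fren f A || fren f B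
  | Imp A B => fren f A --> fren f B
  | All s A => All s (fren (rup f) A)
  | Ex s A => Ex s (fren (rup f) A)
  end.

Fixpoint fsub {G D} (f : substitution G D) (A : form G) : form D :=
  match A with
  | Bot => Bot
  | Eq0 a b => Eq0 (tsub f a) (tsub f b)
  | St a => St (tsub f a)
  | And A B => fsub f A && fsub f B
  | Or A B => fsub f A || fsub f B
  | Imp A B => fsub f A --> fsub f B
  | All s A => All s (fsub (sup f) A)
  | Ex s A => Ex s (fsub (sup f) A)
  end.

Definition fwk {G r} (A : form G) : form (r :: G) := fren shift A.

Definition inst {G r} (A : form (r :: G)) (t : term G r) : form G :=
  fsub (scons t (fun _ v => Var v)) A.

(* A(n) |-> A(S n), where n is variable 0. *)
Definition at_succ {G} (A : form (nat0 :: G)) : form (nat0 :: G) :=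
  fsub (scons (Succ @ #0) (fun _ v => Var (VS v))) A.

(* phi(x, y) with y = #0 and x = #1, moved under one further quantifier that is
   bound outside x and y. *)
Definition wk_under2 {G x y r} (A : form (y :: x :: G)) :
    form (y :: x :: r :: G) :=
  fren (rup (rup shift)) A.

Definition no_var {G} : renaming [] G :=
  fun s v =>
    match v in var G1 s1 return match G1 with [] => var G s1 | _ => unit end with
    | V0 => tt
    | VS _ => tt
    end.

Definition closed_term {G s} (t : term [] s) : term G s := tren no_var t.

(* Classical natural deduction from a set [T] of axioms; axioms may be open
   formulas, which amounts to taking their universal closures. *)
Inductive proves (T : forall G, form G -> Prop) :
    forall G, list (form G) -> form G -> Prop :=
| P_ax : forall G (H : list (form G)) A, T G A -> proves T H A
| P_hyp : forall G (H : list (form G)) A, In A H -> proves T H A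
| P_raa : forall G (H : list (form G)) A,
    proves T (Not A :: H) Bot -> proves T H A
| P_impI : forall G (H : list (form G)) A B,
    proves T (A :: H) B -> proves T H (A --> B)
| P_impE : forall G (H : list (form G)) A B,
    proves T H (A --> B) -> proves T H A -> proves T H B
| P_andI : forall G (H : list (form G)) A B,
    proves T H A -> proves T H B -> proves T H (A && B)
| P_andE1 : forall G (H : list (form G)) A B,
    proves T H (A && B) -> proves T H A
| P_andE2 : forall G (H : list (form G)) A B,
    proves T H (A && B) -> proves T H B
| P_orI1 : forall G (H : list (form G)) A B,
    proves T H A -> proves T H (A || B)
| P_orI2 : forall G (H : list (form G)) A B,
    proves T H B -> proves T H (A || B)
| P_orE : forall G (H : list (form G)) A B C,
    proves T H (A || B) -> proves T (A :: H) C -> proves T (B :: H) C ->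
    proves T H C
| P_allI : forall G (H : list (form G)) s (A : form (s :: G)),
    proves T (map fwk H) A -> proves T H (All s A)
| P_allE : forall G (H : list (form G)) s (A : form (s :: G)) (t : term G s),
    proves T H (All s A) -> proves T H (inst A t)
| P_exI : forall G (H : list (form G)) s (A : form (s :: G)) (t : term G s),
    proves T H (inst A t) -> proves T H (Ex s A)
| P_exE : forall G (H : list (form G)) s (A : form (s :: G)) C,
    proves T H (Ex s A) -> proves T (A :: map fwk H) (fwk C) ->
    proves T H C.

Definition one {G} : term G nat0 := Succ @ Zero.

(* a + b = R b a (fun p _ => S p), the step being the combinator
   Sigma (Pi Pi) S. *)
Definition plus {G} (a b : term G nat0) : term G nat0 :=
  Rec @ b @ a @ (Sigma @ (Pi @ Pi) @ Succ).

Definition le0 {G} (a b : term G nat0) : form G :=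
  Ex nat0 (Eq0 (plus (twk a) #0) (twk b)).

Definition le1 {G} (f h : term G ty1) : form G :=
  All nat0 (le0 (twk f @ #0) (twk h @ #0)).

Definition le1_one {G} (f : term G ty1) : form G :=
  All nat0 (le0 (twk f @ #0) one).

Fixpoint eqt {G} (s : ftype) : term G s -> term G s -> form G :=
  match s with
  | nat0 => fun a b => Eq0 a b
  | arr r t => fun a b => All r (eqt (twk a @ #0) (twk b @ #0))
  end.

Arguments eqt {G s} a b.

(* Strong majorizability; in the functional case v = #1 and u = #0. *)
Fixpoint maj {G} (s : ftype) : term G s -> term G s -> form G :=
  match s with
  | nat0 => fun x y => le0 x y
  | arr r t => fun x y =>
      All r (All r (maj #0 #1 -->
        (maj (twk (twk x) @ #0) (twk (twk y) @ #1) &&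
         maj (twk (twk y) @ #0) (twk (twk y) @ #1))))
  end.

Arguments maj {G s} x y.

Definition monotone {G s} (x : term G s) : form G := maj x x.

Definition AllSt {G} s (A : form (s :: G)) : form G := All s (St #0 --> A).
Definition ExSt {G} s (A : form (s :: G)) : form G := Ex s (St #0 && A).
Definition AllStMon {G} s (A : form (s :: G)) : form G :=
  AllSt (monotone #0 --> A).
Definition ExStMon {G} s (A : form (s :: G)) : form G :=
  ExSt (monotone #0 && A).

Arguments AllSt {G} s A.
Arguments ExSt {G} s A.
Arguments AllStMon {G} s A.
Arguments ExStMon {G} s A.

(* Axioms in free variables are given through all their instances by terms. *)
Inductive EPA : forall G, form G -> Prop :=
| eq_refl0 : forall G (a : term G nat0), EPA (Eq0 a a)
| eq_sym0 : forall G (a b : term G nat0), EPA (Eq0 a b --> Eq0 b a)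
| eq_trans0 : forall G (a b c : term G nat0),
    EPA (Eq0 a b --> Eq0 b c --> Eq0 a c)
| extensionality : forall G s t (z : term G (s ==> t)) (x y : term G s),
    EPA (eqt x y --> eqt (z @ x) (z @ y))
| succ_neq0 : forall G (a : term G nat0), EPA (Not (Eq0 (Succ @ a) Zero))
| succ_inj : forall G (a b : term G nat0),
    EPA (Eq0 (Succ @ a) (Succ @ b) --> Eq0 a b)
| Pi_eq : forall G s t (x : term G s) (y : term G t),
    EPA (eqt (Pi @ x @ y) x)
| Sigma_eq : forall G r s t (x : term G (r ==> s ==> t))
    (y : term G (r ==> s)) (z : term G r),
    EPA (eqt (Sigma @ x @ y @ z) (x @ z @ (y @ z)))
| Rec_zero : forall G s (y : term G s) (z : term G (s ==> nat0 ==> s)),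
    EPA (eqt (Rec @ Zero @ y @ z) y)
| Rec_succ : forall G s (n : term G nat0) (y : term G s)
    (z : term G (s ==> nat0 ==> s)),
    EPA (eqt (Rec @ (Succ @ n) @ y @ z) (z @ (Rec @ n @ y @ z) @ n))
| induction : forall G (A : form (nat0 :: G)), internal A ->
    EPA (inst A Zero && All nat0 (A --> at_succ A) --> All nat0 A).

Inductive EPAst : forall G, form G -> Prop :=
| EPAst_EPA : forall G (A : form G), EPA A -> EPAst A
| st_eq : forall G s (x y : term G s), EPAst (eqt x y --> St x --> St y)
| st_maj : forall G s (x y : term G s), EPAst (St y --> maj x y --> St x)
| st_closed : forall G s (t : term [] s),
    EPAst (G := G) (St (closed_term t))
| st_app : forall G s t (z : term G (s ==> t)) (x : term G s),
    EPAst (St z --> St x --> St (z @ x))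
| external_induction : forall G (A : form (nat0 :: G)),
    EPAst (inst A Zero && AllSt nat0 (A --> at_succ A) --> AllSt nat0 A).

(* In [mAC] and [realization], phi(x, y) has y = #0 and x = #1. *)
Inductive M : forall G, form G -> Prop :=
| M_EPAst : forall G (A : form G), EPAst A -> M A
| mAC : forall G s t (phi : form (t :: s :: G)), internal phi ->
    M (AllStMon s (ExStMon t phi) -->
       ExStMon (s ==> t) (AllStMon s
         (Ex t (maj #0 (#2 @ #1) && wk_under2 phi))))
| realization : forall G s t (phi : form (t :: s :: G)), internal phi ->
    M (All s (ExSt t phi) -->
       ExStMon t (All s (Ex t (maj #0 #2 && wk_under2 phi))))
| MAJ : forall G s, M (G := G) (AllSt s (ExSt s (maj #1 #0))).

Definition M_proves (A : form []) : Prop := proves M [] A.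

(* Main.v *)
From Stdlib Require Import List.
Require Import Defs.
Import ListNotations.

(** The bound on a standard [phi] is read off from a majorant.  By [MAJ] there
    are standard [h'] and [phi'] with [h <=* h'] and [phi <=* phi'].  If
    [f <=_1 h], then [f <=* h'] ([maj_of_le1]): for [u <= v] we have
    [f u <= h u <= h' v].  Majorization is preserved by application
    ([maj_app]), so [phi f <= phi' h'], and the number [phi' h'] does not
    depend on [f] and is standard as the value of a standard functional at a
    standard argument ([standard_bound]).  Cantor space is the case where [h]
    is the closed term [Pi one], the constant function 1 ([le1_Pi_one]).

    The arithmetic behind this is transitivity of [<=].  It amounts to
    associativity of addition, since [a <= b] is defined as solvability of
    [a + x = b], and associativity is proved by induction from the recursion
    equations of addition ([plus_0], [plus_S]).

    Statements whose proofs enter the scope of a quantifier or add hypotheses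
    are given as derivable implications for every context and every list of
    hypotheses; they can then be used directly below any number of binders,
    where a derivation from given premises would first have to be weakened. *)

Set Implicit Arguments.

(** * Substitution calculus *)

(** Fusing two maps into one decides the equations about weakened terms below:
    a lifted map composed with the shift computes to the original map followed
    by the shift, so that both sides fuse to convertible maps. *)
Lemma tren_tren G D E (f : renaming D E) (g : renaming G D) s (t : term G s) :
  tren f (tren g t) = tren (fun r v => f r (g r v)) t.
Proof. induction t; cbn; congruence. Qed.

Lemma tsub_tren G D E (f : substitution D E) (g : renaming G D) s
    (t : term G s) :
  tsub f (tren g t) = tsub (fun r v => f r (g r v)) t.
Proof. induction t; cbn; congruence. Qed.

Lemma tren_tsub G D E (f : renaming D E) (g : substitution G D) s
    (t : term G s) :
  tren f (tsub g t) = tsub (fun r v => tren f (g r v)) t.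
Proof. induction t; cbn; congruence. Qed.

Lemma tsub_renaming G D (g : renaming G D) s (t : term G s) :
  tsub (fun r v => Var (g r v)) t = tren g t.
Proof. induction t; cbn; congruence. Qed.

Lemma tsub_Var G s (t : term G s) : tsub (fun r v => Var v) t = t.
Proof. induction t; cbn; congruence. Qed.

Lemma tren_shift G r s (t : term G s) : tren (@shift G r) t = twk t.
Proof. reflexivity. Qed.

Lemma tren_rup_twk G D (f : renaming G D) r s (t : term G s) :
  tren (rup f) (twk t) = twk (r := r) (tren f t).
Proof. unfold twk. now rewrite !tren_tren. Qed.

Lemma tsub_sup_twk G D (f : substitution G D) r s (t : term G s) :
  tsub (sup f) (twk t) = twk (r := r) (tsub f t).
Proof. unfold twk. now rewrite tsub_tren, tren_tsub. Qed.

Lemma tsub_scons_twk G D (f : substitution G D) r (u : term D r) s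
    (t : term G s) :
  tsub (scons u f) (twk t) = tsub f t.
Proof. unfold twk. now rewrite tsub_tren. Qed.

Lemma tsub_VS G r s (t : term G s) :
  tsub (fun q v => Var (VS v)) t = twk (r := r) t.
Proof. apply (tsub_renaming shift). Qed.

Create HintDb subst.
#[local] Hint Rewrite tren_shift tren_rup_twk tsub_sup_twk tsub_scons_twk
  tsub_VS tsub_Var : subst.

Ltac subst_simpl := cbn; repeat progress (autorewrite with subst; cbn).

Lemma fren_le0 G D (f : renaming G D) a b :
  fren f (le0 a b) = le0 (tren f a) (tren f b).
Proof. unfold le0, plus. subst_simpl. reflexivity. Qed.

Lemma fsub_le0 G D (f : substitution G D) a b :
  fsub f (le0 a b) = le0 (tsub f a) (tsub f b).
Proof. unfold le0, plus. subst_simpl. reflexivity. Qed.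

Lemma fsub_eqt s : forall G D (f : substitution G D) (a b : term G s),
  fsub f (eqt a b) = eqt (tsub f a) (tsub f b).
Proof.
  induction s as [|r _ t IH]; intros; [reflexivity|].
  cbn. now rewrite IH; subst_simpl.
Qed.

Lemma fren_maj s : forall G D (f : renaming G D) (a b : term G s),
  fren f (maj a b) = maj (tren f a) (tren f b).
Proof.
  induction s as [|r IHr t IHt]; intros; [apply fren_le0|].
  cbn. now rewrite IHr, !IHt; subst_simpl.
Qed.

Lemma fsub_maj s : forall G D (f : substitution G D) (a b : term G s),
  fsub f (maj a b) = maj (tsub f a) (tsub f b).
Proof.
  induction s as [|r IHr t IHt]; intros; [apply fsub_le0|].
  cbn. now rewrite IHr, !IHt; subst_simpl.
Qed.

Lemma fren_le1 G D (f : renaming G D) a b :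
  fren f (le1 a b) = le1 (tren f a) (tren f b).
Proof. unfold le1. cbn [fren]. rewrite fren_le0. now subst_simpl. Qed.

#[local] Hint Rewrite fren_le0 fsub_le0 fsub_eqt fren_maj fsub_maj
  fren_le1 : subst.

(** * Derived rules *)

Lemma proves_mono (T U : forall G, form G -> Prop) :
  (forall G (A : form G), T G A -> U G A) ->
  forall G (H : list (form G)) A, proves T H A -> proves U H A.
Proof. intros TU G H A p; induction p; eauto using proves. Qed.

Lemma M_of_EPA G (H : list (form G)) A : proves EPA H A -> proves M H A.
Proof. apply proves_mono. intros; now apply M_EPAst, EPAst_EPA. Qed.

Lemma impE2 T G (H : list (form G)) A B C :
  proves T H (A --> B --> C) -> proves T H A -> proves T H B -> proves T H C.
Proof. intros p a b. exact (P_impE (P_impE p a) b). Qed.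

Lemma allE_eq T G (H : list (form G)) s (A : form (s :: G)) (t : term G s) B :
  proves T H (All s A) -> inst A t = B -> proves T H B.
Proof. intros p <-. now apply P_allE. Qed.

Lemma exI_eq T G (H : list (form G)) s (A : form (s :: G)) (t : term G s) B :
  proves T H B -> inst A t = B -> proves T H (Ex s A).
Proof. intros p <-. now apply P_exI with t. Qed.

Ltac inst_simpl := unfold inst, plus; subst_simpl; reflexivity.

(** * Equality of numbers *)

Lemma Eq0_sym G (H : list (form G)) a b :
  proves EPA H (Eq0 a b) -> proves EPA H (Eq0 b a).
Proof. apply P_impE, P_ax, eq_sym0. Qed.

Lemma Eq0_trans G (H : list (form G)) a b c :
  proves EPA H (Eq0 a b) -> proves EPA H (Eq0 b c) -> proves EPA H (Eq0 a c).
Proof. apply impE2, P_ax, eq_trans0. Qed.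

Lemma eqt_app G (H : list (form G)) s t (z : term G (s ==> t)) x y :
  proves EPA H (eqt x y) -> proves EPA H (eqt (z @ x) (z @ y)).
Proof. apply P_impE, P_ax, extensionality. Qed.

Lemma eqt_arr G (H : list (form G)) s t (x y : term G (s ==> t)) z :
  proves EPA H (eqt x y) -> proves EPA H (eqt (x @ z) (y @ z)).
Proof. intro p. apply (allE_eq z p). inst_simpl. Qed.

Lemma Eq0_plus_l G (H : list (form G)) a a' b :
  proves EPA H (Eq0 a a') -> proves EPA H (Eq0 (plus a b) (plus a' b)).
Proof.
  intro p. apply (eqt_arr (t := nat0)).
  exact (eqt_app (s := nat0) (Rec @ b) _ _ p).
Qed.

Lemma Eq0_plus_r G (H : list (form G)) a b b' :
  proves EPA H (Eq0 b b') -> proves EPA H (Eq0 (plus a b) (plus a b')).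
Proof.
  intro p. apply (eqt_arr (t := nat0)), (eqt_arr (t := _ ==> nat0)).
  exact (eqt_app (s := nat0) Rec _ _ p).
Qed.

Lemma plus_0 G (H : list (form G)) a : proves EPA H (Eq0 (plus a Zero) a).
Proof. apply P_ax. apply (Rec_zero (s := nat0)). Qed.

(** The recursor step [Sigma (Pi Pi) S] sends [x] and [b] to
    [Pi Pi x (S x) b], hence to [S x]. *)
Lemma plus_S G (H : list (form G)) a b :
  proves EPA H (Eq0 (plus a (Succ @ b)) (Succ @ plus a b)).
Proof.
  eapply Eq0_trans; [apply P_ax, (Rec_succ (s := nat0))|].
  fold (plus a b).
  apply Eq0_trans with (b := Pi @ Pi @ plus a b @ (Succ @ plus a b) @ b).
  { apply (eqt_arr (s := nat0) (t := nat0)), P_ax, Sigma_eq. }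
  apply Eq0_trans with (b := Pi @ (Succ @ plus a b) @ b).
  - apply (eqt_arr (s := nat0) (t := nat0)).
    apply (eqt_arr (s := nat0) (t := nat0 ==> nat0)).
    apply P_ax, Pi_eq.
  - apply P_ax, (Pi_eq (s := nat0)).
Qed.

Lemma plus_assoc G (H : list (form G)) a b c :
  proves EPA H (Eq0 (plus (plus a b) c) (plus a (plus b c))).
Proof.
  pose (A := Eq0 (plus (plus (twk a) (twk b)) #0)
               (plus (twk (r := nat0) a) (plus (twk b) #0))).
  apply (allE_eq (A := A) c); [|inst_simpl].
  eapply P_impE; [apply P_ax, (induction A); cbn; tauto|]. apply P_andI.
  - replace (inst A Zero) with
      (Eq0 (plus (plus a b) Zero) (plus a (plus b Zero))) by inst_simpl.
    eapply Eq0_trans; [apply plus_0|].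
    apply Eq0_plus_r, Eq0_sym, plus_0.
  - apply P_allI, P_impI. unfold at_succ, A, plus. subst_simpl.
    change (proves EPA (A :: map fwk H)
      (Eq0 (plus (plus (twk a) (twk b)) (Succ @ #0))
         (plus (twk a) (plus (twk b) (Succ @ #0))))).
    eapply Eq0_trans; [apply plus_S|].
    eapply Eq0_trans; [apply (eqt_app (t := nat0)), P_hyp; now left|].
    eapply Eq0_trans; [apply Eq0_sym, plus_S|].
    apply Eq0_plus_r, Eq0_sym, plus_S.
Qed.

(** * The order on numbers and majorization *)

Lemma le0_of_Eq0 G (H : list (form G)) a b :
  proves EPA H (Eq0 a b) -> proves EPA H (le0 a b).
Proof.
  intro p. apply exI_eq with (t := Zero) (B := Eq0 (plus a Zero) b);
    [|inst_simpl].
  exact (Eq0_trans (plus_0 H a) p).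
Qed.

(** From [a + x = b] and [b + y = c] one gets [a + (x + y) = c]. *)
Lemma le0_trans G (H : list (form G)) a b c :
  proves EPA H (le0 a b --> le0 b c --> le0 a c).
Proof.
  apply P_impI, P_impI.
  eapply P_exE; [apply P_hyp; right; left; reflexivity|].
  eapply P_exE.
  { apply P_hyp; right; left. unfold fwk. rewrite fren_le0. reflexivity. }
  unfold fwk. rewrite !fren_le0.
  apply exI_eq with (t := plus #1 #0)
    (B := Eq0 (plus (twk (twk a)) (plus #1 #0)) (twk (twk c))); [|inst_simpl].
  apply Eq0_trans with (plus (twk (twk b)) #0).
  - eapply Eq0_trans; [apply Eq0_sym, plus_assoc|].
    apply Eq0_plus_l, P_hyp. right; left. inst_simpl.
  - apply P_hyp. left. reflexivity.
Qed.

Lemma maj_app G (H : list (form G)) s t (x y : term G (s ==> t)) u v :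
  proves EPA H (maj x y && maj u v -->
                maj (x @ u) (y @ v) && maj (y @ u) (y @ v)).
Proof.
  apply P_impI.
  eapply P_impE; [|eapply P_andE2, P_hyp; left; reflexivity].
  eapply allE_eq with (t := u); [eapply allE_eq with (t := v)|].
  - eapply P_andE1. apply P_hyp. left. reflexivity.
  - reflexivity.
  - inst_simpl.
Qed.

(** The majorant [m] bounds [h] at all smaller arguments too; it does the
    work of the running maximum of [h]. *)
Lemma maj_of_le1 G (H : list (form G)) f h m :
  proves EPA H (le1 f h && maj h m --> maj f m).
Proof.
  apply P_impI. apply P_allI, P_allI, P_impI. cbn [map].
  unfold fwk. cbn [fren]. rewrite !fren_le1, !fren_maj, !tren_shift.
  match goal with |- proves _ ?L _ => set (K := L) end.
  assert (app : proves EPA K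
    (maj (twk (twk h) @ #0) (twk (twk m) @ #1) &&
     maj (twk (twk m) @ #0) (twk (twk m) @ #1))).
  { eapply P_impE; [apply maj_app|]. apply P_andI.
    - eapply P_andE2. apply P_hyp. right. left. reflexivity.
    - apply P_hyp. left. reflexivity. }
  apply P_andI; [|exact (P_andE2 app)].
  eapply impE2; [apply le0_trans| |exact (P_andE1 app)].
  eapply allE_eq with (t := #0).
  - eapply P_andE1. apply P_hyp. right. left. reflexivity.
  - inst_simpl.
Qed.

(** The witness is the majorant of [phi] applied to the majorant of [h]. *)
Lemma standard_bound G (H : list (form G)) h phi :
  proves M H (St h --> St phi -->
    ExSt nat0 (All ty1 (le1 #0 (twk (twk h)) -->
                        le0 (twk (twk phi) @ #0) #1))).
Proof.
  apply P_impI, P_impI.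
  apply P_exE with (s := ty1) (A := St #0 && maj (twk h) #0).
  { eapply P_impE; [|apply P_hyp; right; left; reflexivity].
    eapply allE_eq with (t := h); [apply P_ax, MAJ|inst_simpl]. }
  apply P_exE with (s := ty2) (A := St #0 && maj (twk (twk phi)) #0).
  { eapply P_impE; [|apply P_hyp; right; left; reflexivity].
    eapply allE_eq with (t := twk phi); [apply P_ax, MAJ|inst_simpl]. }
  eapply exI_eq with (t := #0 @ #1)
    (B := St (#0 @ #1) && All ty1 (le1 #0 (twk (twk (twk h))) -->
                        le0 (twk (twk (twk phi)) @ #0) (#1 @ #2))); [|inst_simpl].
  unfold fwk. cbn [map fren]. rewrite !fren_maj.
  apply P_andI.
  - eapply impE2; [apply P_ax, M_EPAst, st_app| |].
    + eapply P_andE1. apply P_hyp. left. reflexivity.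
    + eapply P_andE1. apply P_hyp. right. left. reflexivity.
  - apply P_allI, P_impI.
    apply M_of_EPA.
    (* At type 0 majorization is [le0]. *)
    refine (@P_andE1 _ _ _ (maj (s := nat0) (twk (twk (twk phi)) @ #0) (#1 @ #2))
                          (maj (s := nat0) (#1 @ #0) (#1 @ #2)) _).
    unfold fwk. cbn [map fren]. rewrite !fren_maj.
    eapply P_impE; [apply maj_app|]. apply P_andI.
    + eapply P_andE2. apply P_hyp. right. left. reflexivity.
    + eapply P_impE; [apply maj_of_le1|]. apply P_andI.
      * apply P_hyp. left. reflexivity.
      * eapply P_andE2. apply P_hyp. right. right. left. reflexivity.
Qed.

Lemma le1_Pi_one G (H : list (form G)) f :
  proves EPA H (le1_one f --> le1 f (Pi @ one)).
Proof.
  apply P_impI, P_allI. eapply impE2; [apply le0_trans with (b := one)| |].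
  - eapply allE_eq with (t := #0).
    + apply P_hyp. left. unfold fwk. cbn [fren]. reflexivity.
    + inst_simpl.
  - apply le0_of_Eq0, Eq0_sym, P_ax. apply (Pi_eq (s := nat0)).
Qed.

Theorem theorem1p13 :
  M_proves
    (AllSt ty2 (ExSt nat0 (All ty1 (le1_one #0 --> le0 (#2 @ #0) #1))))
  /\
  M_proves
    (AllSt ty1 (AllSt ty2 (ExSt nat0 (All ty1
       (le1 #0 #3 --> le0 (#2 @ #0) #1))))).
Proof.
  split.
  - apply P_allI, P_impI.
    eapply P_exE.
    { eapply impE2; [apply standard_bound with (h := Pi @ one)| |].
      - apply P_ax, M_EPAst. apply (st_closed _ (Pi @ one)).
      - apply P_hyp. left. reflexivity. }
    eapply exI_eq with (t := #0); [|inst_simpl].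
    apply P_andI; [eapply P_andE1; apply P_hyp; left; reflexivity|].
    apply P_allI, P_impI.
    eapply P_impE.
    + eapply allE_eq with (t := #0).
      * eapply P_andE2. apply P_hyp. right. left. reflexivity.
      * inst_simpl.
    + eapply P_impE; [|apply P_hyp; left; reflexivity].
      apply M_of_EPA.
      exact (le1_Pi_one _ #0).
  - apply P_allI, P_impI, P_allI, P_impI.
    eapply impE2; [apply standard_bound with (h := #1) (phi := #0)| |].
    + apply P_hyp. right. left. reflexivity.
    + apply P_hyp. left. reflexivity.
Qed.
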